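(* Let $m,n,s,k$ be four integers such that $3\leq s\leq n$, $3\leq k\leq m$ and $ms=nk$. Set $d=\gcd(s,k)$ and suppose $d\geq 2$. If $d$ is even or $nk$ is odd, then there exists a magic rectangle $\mathrm{MR}(m,n;s,k)$.
   Context: A partially filled (pf) array is a matrix some of whose cells may be empty; row and column sums are taken over the filled cells. A magic rectangle $\mathrm{MR}(m,n;s,k)$ is an $m\times n$ pf array with entries in $\Omega=\{0,1,\ldots,nk-1\}\subset\mathbb{Z}$ such that: (a) each row contains exactly $s$ filled cells and each column contains exactly $k$ filled cells; (b) every $x\in\Omega$ appears exactly once in the array; (c) the sum of the elements in each row is a constant value $c_1$ and the sum of the elements in each column is a constant value $c_2$. *)

(* Defs.v *)
From mathcomp Require Import all_boot all_algebra.

Set Implicit Arguments.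
Unset Strict Implicit.
Unset Printing Implicit Defensive.

(* A partially filled array; [None] is an empty cell.  All entries of a magic
   rectangle lie in {0, ..., nk - 1}, so naturals suffice. *)
Definition pf_array (m n : nat) := 'M[option nat]_(m, n).

Definition filled (m n : nat) (A : pf_array m n) (i : 'I_m) (j : 'I_n) : bool :=
  isSome (A i j).

Definition row_sum (m n : nat) (A : pf_array m n) (i : 'I_m) : nat :=
  \sum_(j < n | filled A i j) odflt 0 (A i j).

Definition col_sum (m n : nat) (A : pf_array m n) (j : 'I_n) : nat :=
  \sum_(i < m | filled A i j) odflt 0 (A i j).

Record magic_rectangle (m n s k : nat) (A : pf_array m n) : Prop :=
  MagicRectangle {
    mr_entries : forall i j x, A i j = Some x -> x < n * k;
    mr_row_filled : forall i, #|[set j | filled A i j]| = s;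
    mr_col_filled : forall j, #|[set i | filled A i j]| = k;
    mr_once : forall x, x < n * k ->
      #|[set c : 'I_m * 'I_n | A c.1 c.2 == Some x]| = 1;
    mr_row_sum : exists c1, forall i, row_sum A i = c1;
    mr_col_sum : exists c2, forall j, col_sum A j = c2
  }.

(* Main.v *)
(* Write s = a d, k = b d with a, b coprime; then n = a t and m = b t with d <= t.
   Put L = a b t.  Reading the row index modulo m and the column index modulo n of a
   cell on one of d consecutive cyclic diagonals of an L x L square is injective:
   two cells with the same image lie on diagonals congruent modulo t, hence on the same
   diagonal, and then coincide by the Chinese remainder theorem.

   If d and L are odd, diagonal e receives the entries L e + rho_e(x), x in Z/L, with
   rho_e affine.  The residues of x and -1-x have constant sum, and so do those of
   x, hx-1, hx+h when L = 2h+1 (h plays the role of -1/2); the rho_e are chosen so that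
   both each row and each column split into such pairs and one such triple.

   If d = 2 d', the cells are grouped into horizontal dominoes filled with complementary
   entries G and nk-1-G.  All row sums are then equal, and the column sums are equal as
   soon as the entries G in the left halves of the dominoes have equal column sums. *)
Require Import Defs.
From mathcomp Require Import all_boot all_algebra.
From mathcomp Require Import zify ring.

Set Implicit Arguments.
Unset Strict Implicit.
Unset Printing Implicit Defensive.

Import GRing.Theory.

(** * Arrays presented by abstract labelled cells *)

(** Each index [p] stands for the filled cell [(r p, c p)] with entry [g p]. As [P] has [n * k]
    elements, the injective map [g] is onto, so every label occurs exactly once. *)
Lemma magic_rectangle_of_labelling (m n s k c1 c2 : nat) (P : finType)
    (r c g : P -> nat) :
    (forall p, r p < m) -> (forall p, c p < n) -> (forall p, g p < n * k) ->
    (forall p q, r p = r q -> c p = c q -> p = q) -> injective g ->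
    #|P| = n * k ->
    (forall i, i < m -> \sum_(p | r p == i) 1 = s) ->
    (forall j, j < n -> \sum_(p | c p == j) 1 = k) ->
    (forall i, i < m -> \sum_(p | r p == i) g p = c1) ->
    (forall j, j < n -> \sum_(p | c p == j) g p = c2) ->
  exists A : pf_array m n, magic_rectangle s k A.
Proof.
move=> rP cP gP rc_inj g_inj cardP rows cols rsum csum.
pose B (i : 'I_m) (j : 'I_n) := [pick p | (r p == i) && (c p == j)].
have sumB F (i : 'I_m) (j : 'I_n) : \sum_(p | (r p == i) && (c p == j)) F p = oapp F 0 (B i j).
  rewrite /B; case: pickP => [p /andP[/eqP rp /eqP cp]|no] /=; last by rewrite big_pred0.
  rewrite (big_pred1 p) // => q /=; apply/andP/eqP => [[/eqP rq /eqP cq]|-> //].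
    by apply: rc_inj; rewrite ?rp ?cp.
  by rewrite rp cp.
have sum_row F (i : 'I_m) : \sum_(p | r p == i) F p = \sum_j oapp F 0 (B i j).
  rewrite (partition_big (fun p => Ordinal (cP p)) xpredT) //=.
  by apply: eq_bigr => j _; rewrite -sumB; apply: eq_bigl => p; rewrite -val_eqE.
have sum_col F (j : 'I_n) : \sum_(p | c p == j) F p = \sum_i oapp F 0 (B i j).
  rewrite (partition_big (fun p => Ordinal (rP p)) xpredT) //=.
  apply: eq_bigr => i _; rewrite -sumB; apply: eq_bigl => p.
  by rewrite -val_eqE andbC.
exists (\matrix_(i, j) omap g (B i j))%R.
split.
- by move=> i j x; rewrite mxE; case: (B i j) => //= p [<-].
- move=> i; rewrite -(rows i (ltn_ord i)) sum_row -sum1_card big_mkcond.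
  by apply: eq_bigr => j _; rewrite inE /filled mxE; case: (B i j).
- move=> j; rewrite -(cols j (ltn_ord j)) sum_col -sum1_card big_mkcond.
  by apply: eq_bigr => i _; rewrite inE /filled mxE; case: (B i j).
- move=> x ltx.
  have [p gp] : exists p, g p = x.
    pose f p : 'I_(n * k) := Ordinal (gP p).
    have f_inj : injective f by move=> p q [/g_inj].
    have := inj_card_onto f_inj; rewrite card_ord cardP => /(_ (leqnn _)) onto.
    by have /codomP[p /(congr1 val) /= xp] := onto (Ordinal ltx); exists p.
  apply/eqP/cards1P; exists (Ordinal (rP p), Ordinal (cP p)).
  apply/setP=> -[i j]; rewrite !inE mxE /=.
  apply/eqP/eqP => [|[-> ->]].
    rewrite /B; case: pickP => [q /andP[/eqP rq /eqP cq] /= [gq]|//].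
    have qp : q = p by apply: g_inj; rewrite gp.
    by rewrite -qp; congr (_, _); apply: val_inj.
  rewrite /B; case: pickP => [q /andP[/eqP rq /eqP cq]|/(_ p)] /=.
    by rewrite (rc_inj _ _ rq cq) gp.
  by rewrite !eqxx.
- exists c1 => i; rewrite -(rsum i (ltn_ord i)) sum_row /row_sum big_mkcond.
  by apply: eq_bigr => j _; rewrite /filled mxE; case: (B i j).
- exists c2 => j; rewrite -(csum j (ltn_ord j)) sum_col /col_sum big_mkcond.
  by apply: eq_bigr => i _; rewrite /filled mxE; case: (B i j).
Qed.

(** * Sums over residue classes, and congruences between cells of diagonals *)

Lemma sum_ord_mul a b (F : nat -> nat) :
  \sum_(u < a * b) F u = \sum_(x < a) \sum_(y < b) F (x * b + y).
Proof.
elim: a => [|a IHa]; first by rewrite mul0n !big_ord0.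
rewrite big_ord_recr /= -IHa mulSn addnC.
by rewrite big_split_ord /=.
Qed.

Lemma sum_residue N a m r (F : nat -> nat) : N = a * m -> r < m ->
  \sum_(u < N | u %% m == r) F u = \sum_(x < a) F (x * m + r).
Proof.
move=> -> ltr; rewrite big_mkcond /=.
rewrite (sum_ord_mul a m (fun u => if u %% m == r then F u else 0)).
apply: eq_bigr => x _; rewrite -big_mkcond /=.
rewrite (big_pred1 (Ordinal ltr)) // => y /=.
by rewrite modnMDl modn_small // -val_eqE.
Qed.

Lemma sum_residue_const N a m r (F : nat -> nat) C : N = a * m -> r < m ->
  (forall u, u < N -> F u = C) -> \sum_(u < N | u %% m == r) F u = a * C.
Proof.
move=> eN ltr FC; rewrite (sum_residue _ eN ltr).
under eq_bigr => x _.
  rewrite FC; last first.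
    by rewrite eN (leq_trans (n := x.+1 * m)) ?leq_mul2r ?ltn_ord ?orbT // mulSn addnC ltn_add2r.
  over.
by rewrite sum_nat_const card_ord.
Qed.

(** Here [w * m.-1] plays the role of [- w] modulo [m], because [w + w * m.-1 = w * m]. *)
Lemma eq_mod_shift m w u r : r < m ->
  ((u + w) %% m == r) = (u %% m == (r + w * m.-1) %% m).
Proof.
move=> ltr; have m_gt0 : 0 < m by case: m ltr.
rewrite -{1}(modn_small ltr) -(eqn_modDr (w * m.-1)) -addnA.
by rewrite -[X in u + (X + _)]muln1 -mulnDr add1n prednK // addnC modnMDl.
Qed.

Lemma sum_pair (I J : finType) (P : pred (I * J)) (F : I * J -> nat) :
  \sum_(p | P p) F p = \sum_j \sum_(i | P (i, j)) F (i, j).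
Proof.
under [RHS]eq_bigr => j _ do rewrite big_mkcond.
rewrite exchange_big pair_bigA big_mkcond.
by apply: eq_bigr => -[].
Qed.

(** The difference is divisible by the lcm of [a * t] and [b * t], which is [a * b * t], yet it is
    smaller than that. *)
Lemma eq_of_modM a b t u v : coprime a b -> u < a * b * t -> v < a * b * t ->
  u = v %[mod a * t] -> u = v %[mod b * t] -> u = v.
Proof.
move=> co_ab; wlog le_uv : u v / u <= v => [hw ltu ltv ua ub|].
  by case: (leqP u v) => [|/ltnW] le; [|symmetry]; apply: hw.
move=> _ ltv /eqP; rewrite eq_sym eqn_mod_dvd // => dva /eqP.
rewrite eq_sym eqn_mod_dvd // => dvb.
have : a * b * t %| v - u.
  have <- : lcmn (a * t) (b * t) = a * b * t.
    by rewrite -muln_lcml -[X in _ = X * _](muln_lcm_gcd a b) (eqP co_ab) muln1.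
  by rewrite dvdn_lcm dva.
case: (posnP (v - u)) => [|pos /(dvdn_leq pos)]; lia.
Qed.

(* Two cells [(u + x, u + y)] and [(v + z, v + w)], read modulo [(a t, b t)], can only
   coincide if their diagonals agree modulo [t]. *)
Lemma diagonal_mod a b t u v x y z w :
  u + x = v + z %[mod a * t] -> u + y = v + w %[mod b * t] ->
  x + w = z + y %[mod t].
Proof.
move=> e1 e2.
have f1 : u + x = v + z %[mod t].
  by rewrite -(modn_dvdm _ (dvdn_mull a (dvdnn t))) e1 modn_dvdm // dvdn_mull.
have f2 : u + y = v + w %[mod t].
  by rewrite -(modn_dvdm _ (dvdn_mull b (dvdnn t))) e2 modn_dvdm // dvdn_mull.
apply/eqP; rewrite -(eqn_modDl (u + v)).
have -> : u + v + (x + w) = u + x + (v + w) by lia.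
have -> : u + v + (z + y) = v + z + (u + y) by lia.
by rewrite -(modnDm (u + x)) f1 -f2 modnDm.
Qed.

(** * Half labellings, used for even [d] *)

(* [G] picks one number out of each pair [{x, 2qn - 1 - x}] of elements of
   [{0, ..., 2qn - 1}] and arranges these in a [q x n] array with equal column sums. *)
Definition half_labelling (q n : nat) (G : nat -> nat -> nat) : Prop :=
  [/\ forall a j, a < q -> j < n -> G a j < 2 * (q * n),
      forall a j b l, a < q -> j < n -> b < q -> l < n ->
        G a j = G b l -> a = b /\ j = l,
      forall a j b l, a < q -> j < n -> b < q -> l < n ->
        (G a j + G b l).+1 <> 2 * (q * n)
    & exists C, forall j, j < n -> \sum_(a < q) G a j = C].

(* The new labels are the outermost ones, so the old ones shift by [2n]. *)
Lemma half_labelling_addn2 q n G : half_labelling q n G ->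
  exists G', half_labelling q.+2 n G'.
Proof.
case=> G_lt G_inj G_compl [C sumG].
exists (fun a j => if a < q then G a j + 2 * n
                   else if a == q then j else 2 * n - j.+1).
split.
- move=> a j lta ltj; case: ifP => [aq|_]; [have := G_lt _ _ aq ltj | case: ifP]; nia.
- move=> a j b l lta ltj ltb ltl.
  have [aq|aq] := ltnP a q; [have := G_lt _ _ aq ltj|];
    (have [bq|bq] := ltnP b q; [have := G_lt _ _ bq ltl|]).
  + by move=> _ _ /addIn; apply: G_inj.
  + by case: ifP; lia.
  + by case: ifP; lia.
  + by do 2 case: ifP; lia.
- move=> a j b l lta ltj ltb ltl.
  have [aq|aq] := ltnP a q; [have := G_lt _ _ aq ltj|];
    (have [bq|bq] := ltnP b q; [have := G_lt _ _ bq ltl|]).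
  + by move=> _ _; have := G_compl _ _ _ _ aq ltj bq ltl; nia.
  + by case: ifP; nia.
  + by case: ifP; nia.
  + by do 2 case: ifP; nia.
exists (C + q * (2 * n) + (2 * n).-1) => j ltj.
rewrite !big_ord_recr /= ltnn eqxx ltnNge leqnSn /= (gtn_eqF (ltnSn q)) -(sumG j ltj).
rewrite (eq_bigr (fun a : 'I_q => G a j + 2 * n)); last by move=> a _; rewrite ltn_ord.
rewrite big_split /= sum_nat_const card_ord; lia.
Qed.

(** The three rows fill three consecutive blocks of [h.*2.+1] numbers, so all labels lie in the
    lower half and no two are complementary. Raising [j] by 2 adds 2 in the first row and subtracts
    1 in each of the others. *)
Lemma half_labelling3_odd h : exists G, half_labelling 3 h.*2.+1 G.
Proof.
exists (fun a j => match a with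
  | 0 => j
  | 1 => if odd j then 3 * h - j./2 else 4 * h + 1 - j./2
  | _ => if odd j then 6 * h + 2 - j./2 else 5 * h + 2 - j./2 end).
have dbl j : j = odd j + j./2.*2 by rewrite odd_double_half.
split.
- move=> [|[|a]] j lta ltj; have := dbl j; try case: ifP; lia.
- move=> [|[|[|a]]] j [|[|[|b]]] l // _ ltj _ ltl; have := dbl j; have := dbl l;
    do ?case: ifP; lia.
- move=> [|[|[|a]]] j [|[|[|b]]] l // _ ltj _ ltl; have := dbl j; have := dbl l;
    do ?case: ifP; lia.
- exists (9 * h + 3) => j ltj; rewrite !big_ord_recr big_ord0 /=.
  have := dbl j; case: ifP; lia.
Qed.

(* The first [p] columns have slopes [(2, -1, -1)] and the last [p] have [(-2, 1, 1)]; the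
   six constants make the absolute values of [2 G - 12 p + 1] tile the odd numbers below
   [12 p]. *)
Lemma half_labelling3_even p : exists G, half_labelling 3 p.*2 G.
Proof.
exists (fun a j => match a with
  | 0 => if j < p then 6 * p + j.*2 else 8 * p - j.+1.*2
  | 1 => if j < p then 9 * p - j.+1 else 10 * p + j
  | _ => if j < p then 3 * p - j.+1 else j end).
split.
- move=> [|[|a]] j lta ltj; case: ifP; lia.
- move=> [|[|[|a]]] j [|[|[|b]]] l // _ ltj _ ltl; do 2 case: ifP; lia.
- move=> [|[|[|a]]] j [|[|[|b]]] l // _ ltj _ ltl; do 2 case: ifP; lia.
- exists (18 * p - 2) => j ltj; rewrite !big_ord_recr big_ord0 /=.
  case: ifP; lia.
Qed.

(** Rows are added two at a time, starting from 0 rows or from 3. A single row of distinct labels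
    has unequal column sums once [n > 1], so odd [q] starts at 3. *)
Lemma half_labelling_exists q n : q != 1 -> exists G, half_labelling q n G.
Proof.
have [N] := ubnP q; elim: N q => // N IHN [|[|[|[|q]]]] // ltq _.
- by exists (fun=> id); split=> //; exists 0 => j _; rewrite big_ord0.
- have [//|//|G /half_labelling_addn2 //] := IHN 0; lia.
- have [o|e] := boolP (odd n).
  + by rewrite -[n]odd_double_half o; apply: half_labelling3_odd.
  + by rewrite -[n]odd_double_half (negPf e); apply: half_labelling3_even.
- have [//||G /half_labelling_addn2 //] := IHN q.+2; lia.
Qed.

(** * Balanced labels on cyclic diagonals of odd length *)

Section OddModulus.

Variable h : nat.
Hypothesis h_gt0 : 0 < h.
Let L := h.*2.+1.
Local Notation ZL := 'Z_L.

Let L_gt1 : 1 < L. Proof. rewrite /L; lia. Qed.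

Let val_nat k : k < L -> (k%:R : ZL)%R = k :> nat.
Proof. by move=> ltk; rewrite val_Zp_nat // modn_small. Qed.

Let double_h : (2 * h%:R = -1 :> ZL)%R.
Proof.
apply/eqP; rewrite -subr_eq0 opprK -natrM natr1.
by rewrite mul2n -/L pchar_Zp.
Qed.

Lemma addn_val_oppZ (x : ZL) : x + (-1 - x)%R = h.*2 :> nat.
Proof.
have ltx : x < L by rewrite -[X in _ < X](Zp_cast L_gt1).
have -> : (-1 - x)%R = (h.*2 - x)%:R%R :> ZL.
  rewrite natrB; last by rewrite /L in ltx *; lia.
  by rewrite natr_Zp -mul2n natrM double_h.
rewrite val_nat; rewrite /L in ltx *; lia.
Qed.

(** As [h] is -1/2, [h%:R * x] equals [- a] for x = 2a and [h - a] for x = 2a + 1; the parity of [x]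
    thus determines the representatives below [L]. *)
Lemma addn_val_kotzig (x : ZL) :
  x + (h%:R * x - 1)%R + (h%:R * x + h%:R)%R = 3 * h :> nat.
Proof.
have ltx : x < L by rewrite -[X in _ < X](Zp_cast L_gt1).
have dx := odd_double_half x; set a := x./2 in dx.
have [o|e] := boolP (odd x).
- rewrite o add1n in dx.
  have lta : a < h by rewrite -ltn_double -ltnS dx.
  have -> : (h%:R * x - 1)%R = (h - a.+1)%:R%R :> ZL.
    rewrite natrB; last by lia.
    rewrite -{1}[x]natr_Zp -dx -natr1 -mul2n natrM -natr1.
    by ring: double_h.
  have -> : (h%:R * x + h%:R)%R = (h.*2 - a)%:R%R :> ZL.
    rewrite natrB; last by lia.
    rewrite -{1}[x]natr_Zp -dx -natr1 -!mul2n !natrM.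
    by ring: double_h.
  rewrite !val_nat -?dx /L; lia.
- rewrite (negPf e) add0n in dx.
  have lea : a <= h by rewrite -leq_double -ltnS dx.
  have -> : (h%:R * x - 1)%R = (h.*2 - a)%:R%R :> ZL.
    rewrite natrB; last by lia.
    rewrite -{1}[x]natr_Zp -dx -!mul2n !natrM.
    by ring: double_h.
  have -> : (h%:R * x + h%:R)%R = (h - a)%:R%R :> ZL.
    rewrite natrB; last by lia.
    rewrite -{1}[x]natr_Zp -dx -!mul2n !natrM.
    by ring: double_h.
  rewrite !val_nat -?dx /L; lia.
Qed.

Let mul_h_inj c : injective (fun x : ZL => h%:R * x + c)%R.
Proof.
move=> x y /addIr /(congr1 (fun z => - (2 * z))%R) /=.
by rewrite !mulrA double_h !mulN1r !opprK.
Qed.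

Let sub_inj c : injective (fun x : ZL => c - x)%R.
Proof. by move=> x y /addrI/oppr_inj. Qed.

(** [rho e x] is the residue placed in row [x] of diagonal [e], that is, in column [x + e]; the last
    two clauses concern rows and columns. The mean of 0, ..., 2h is [h]. *)
Definition balanced_diagonals d (rho : nat -> ZL -> ZL) : Prop :=
  [/\ forall e, injective (rho e),
      forall x, \sum_(e < d) rho e x = d * h :> nat
    & forall x, \sum_(e < d) rho e (x - e%:R)%R = d * h :> nat].

(** Row [x] carries the triple of [- x] and column [x] that of [1 - x]; between the two, diagonals 0
    and 2 exchange roles. *)
Lemma balanced_diagonals3 : exists rho, balanced_diagonals 3 rho.
Proof.
pose rho e (x : ZL) : ZL := (match e with
  | 0 => h%:R * (- x) - 1 | 1 => - x | _ => h%:R * (- x) + h%:R end)%R.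
have sum3 (f : nat -> nat) : \sum_(e < 3) f e = f 0 + f 1 + f 2.
  by rewrite !big_ord_recr big_ord0.
exists rho.
split.
- move=> [|[|e]] x y.
  + by move/mul_h_inj/oppr_inj.
  + by move/oppr_inj.
  + by move/mul_h_inj/oppr_inj.
- move=> x; rewrite [LHS](sum3 (fun e => rho e x)) /rho.
  by rewrite -(addn_val_kotzig (- x)%R) [X in X + _ = _]addnC.
- move=> x; rewrite [LHS](sum3 (fun e => rho e (x - e%:R)%R)) /rho.
  rewrite -(addn_val_kotzig (1 - x)%R).
  have -> : (- (x - 1) = 1 - x)%R by ring.
  have -> : (h%:R * - (x - 0) - 1 = h%:R * (1 - x) + h%:R)%R by ring: double_h.
  have -> : (h%:R * - (x - 2%:R) + h%:R = h%:R * (1 - x) + (2 * h%:R))%R by ring.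
  rewrite double_h.
  by rewrite [RHS]addnAC [X in X + _ = _]addnC.
Qed.

(** In rows, diagonals 0, 2 form a pair and 4, 3, 1 the triple of [x + 2]. In columns, 2, 4 form a
    pair and 0, 1, 3 the triple of [x]. *)
Lemma balanced_diagonals5 : exists rho, balanced_diagonals 5 rho.
Proof.
pose rho e (x : ZL) : ZL := (match e with
  | 0 => x | 1 => h%:R * x + (h%:R - 1) | 2 => -1 - x
  | 3 => h%:R * x - 2%:R | _ => x + 2%:R end)%R.
have sum5 (f : nat -> nat) : \sum_(e < 5) f e = f 0 + f 1 + f 2 + f 3 + f 4.
  by rewrite !big_ord_recr big_ord0.
exists rho; split.
- move=> [|[|[|[|e]]]] x y //.
  + by move/mul_h_inj.
  + by move/sub_inj.
  + by move/mul_h_inj.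
  + by move/addIr.
- move=> x; rewrite [LHS](sum5 (fun e => rho e x)) /rho.
  rewrite (mulnDl 2 3) mul2n -(addn_val_oppZ x) -(addn_val_kotzig (x + 2%:R)%R).
  have -> : (h%:R * (x + 2%:R) - 1 = h%:R * x - 2%:R)%R by ring: double_h.
  have -> : (h%:R * (x + 2%:R) + h%:R = h%:R * x + (h%:R + 2 * h%:R))%R by ring.
  rewrite double_h.
  ring.
- move=> x; rewrite [LHS](sum5 (fun e => rho e (x - e%:R)%R)) /rho subr0.
  rewrite (mulnDl 3 2) mul2n -(addn_val_oppZ (x - 2%:R)%R) -(addn_val_kotzig x).
  have -> : (h%:R * (x - 1) + (h%:R - 1) = h%:R * x - 1)%R by ring.
  have -> : (h%:R * (x - 3%:R) - 2%:R = h%:R * x + h%:R - 2 * (2 * h%:R + 1))%R by ring.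
  rewrite double_h addNr mulr0 subr0.
  have -> : (x - 4%:R + 2%:R = x - 2%:R)%R by ring.
  ring.
Qed.

(** The four new diagonals split into complementary pairs in two ways: first with second and third
    with fourth in rows, first with third and second with fourth in columns. *)
Lemma balanced_diagonals_addn4 d rho : balanced_diagonals d rho ->
  exists rho', balanced_diagonals d.+4 rho'.
Proof.
case=> rho_inj rowE colE.
pose tail f (x : ZL) : ZL :=
  match f with 0 => x | 1 => -1 - x | 2 => -3%:R - x | _ => x + 2%:R end%R.
pose rho' e := if e < d then rho e else tail (e - d).
have sumE (F : nat -> ZL) : \sum_(e < d.+4) rho' e (F e) =
    \sum_(e < d) rho e (F e) + tail 0 (F d) + tail 1 (F d.+1)
      + tail 2 (F d.+2) + tail 3 (F d.+3) :> nat.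
  have tailE j : rho' (d + j) = tail j by rewrite /rho' ltnNge leq_addr addKn.
  rewrite -(tailE 0) -(tailE 1) -(tailE 2) -(tailE 3) addn0 addn1 addn2 addn3.
  rewrite 4!big_ord_recr; congr (_ + _ + _ + _ + _).
  by apply: eq_bigr => e _; rewrite /rho' /= ltn_ord.
exists rho'; split.
- move=> e x y; rewrite /rho'; case: ifP => _; first exact: rho_inj.
  case: (e - d) => [|[|[|f]]] //=; [exact: sub_inj|exact: sub_inj|exact: addIr].
- move=> x; rewrite (sumE (fun=> x)) rowE /tail.
  have -> : (-3%:R - x = -1 - (x + 2%:R))%R by ring.
  rewrite -(addn4 d) mulnDl (mulnDl 2 2) !mul2n.
  rewrite -{1}(addn_val_oppZ x) -(addn_val_oppZ (x + 2%:R)%R).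
  ring.
- move=> x; rewrite (sumE (fun e => x - e%:R)%R) colE /tail.
  have -> : (-1 - (x - d.+1%:R) = - (x - d%:R))%R by rewrite -natr1; ring.
  have -> : (-3%:R - (x - d.+2%:R) = -1 - (x - d%:R))%R by rewrite -!natr1; ring.
  have -> : (x - d.+3%:R + 2%:R = -1 - (- (x - d%:R)))%R by rewrite -!natr1; ring.
  rewrite -(addn4 d) mulnDl (mulnDl 2 2) !mul2n.
  rewrite -{1}(addn_val_oppZ (x - d%:R)%R) -(addn_val_oppZ (- (x - d%:R))%R).
  ring.
Qed.

Lemma balanced_diagonals_exists d : odd d -> 3 <= d ->
  exists rho, balanced_diagonals d rho.
Proof.
have [N] := ubnP d; elim: N d => // N IHN [|[|[|[|[|[|[|d]]]]]]] // ltd od _.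
- exact: balanced_diagonals3.
- exact: balanced_diagonals5.
- have [|||rho /balanced_diagonals_addn4 //] := IHN d.+3; last by [].
  + lia.
  + by move: od; rewrite /= !negbK.
Qed.

End OddModulus.

(** * Assembly for odd [d] *)

Lemma magic_rectangle_odd a b t d : coprime a b -> 0 < a -> 0 < b ->
  odd (a * b * t) -> odd d -> 3 <= d -> d <= t ->
  exists A : pf_array (b * t) (a * t), magic_rectangle (a * d) (b * d) A.
Proof.
move=> co_ab a_gt0 b_gt0 oL od d_gt2 le_dt.
have t_gt0 : 0 < t by lia.
pose L := a * b * t; set m := b * t; set n := a * t.
have m_gt0 : 0 < m by rewrite muln_gt0 b_gt0.
have n_gt0 : 0 < n by rewrite muln_gt0 a_gt0.
have le_tL : t <= L by rewrite /L -{1}[t]mul1n leq_mul2r muln_gt0 a_gt0 b_gt0 orbT.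
have [h eL] : exists h, L = h.*2.+1.
  by exists L./2; rewrite -{1}[L]odd_double_half [odd L]oL.
have h_gt0 : 0 < h by lia.
have [rho [rho_inj rowE colE]] := balanced_diagonals_exists h_gt0 od d_gt2.
have L_gt1 : 1 < L by lia.
rewrite -eL in rho rho_inj rowE colE.
have ZL : (Zp_trunc L).+2 = L := Zp_cast L_gt1.
have ltL (x : 'Z_L) : x < L by rewrite -[X in _ < X]ZL.
have ZLm : (Zp_trunc L).+2 = a * m by rewrite ZL /L /m mulnA.
have ZLn : (Zp_trunc L).+2 = b * n by rewrite ZL /L /n mulnCA mulnA.
have valD (x : 'Z_L) e : e < d -> (x + e%:R)%R %% n = (x + e) %% n.
  move=> lte; rewrite /= val_Zp_nat // (modn_small (leq_trans lte _)); last by lia.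
  by rewrite modn_dvdm // ZLn dvdn_mull.
pose r (p : 'Z_L * 'I_d) := p.1 %% m.
pose c (p : 'Z_L * 'I_d) := (p.1 + p.2%:R : 'Z_L)%R %% n.
pose g (p : 'Z_L * 'I_d) := L * p.2 + rho p.2 p.1.
have rowC F C i : i < m -> (forall x : 'Z_L, \sum_(e < d) F (x, e) = C) ->
    \sum_(p | r p == i) F p = a * C.
  move=> lti FC; rewrite sum_pair /r /= exchange_big /=.
  rewrite (eq_bigr (fun=> C)) => [|x _]; last exact: FC.
  exact: (sum_residue_const ZLm lti).
have colC F C j : j < n ->
    (forall x : 'Z_L, \sum_(e < d) F ((x - e%:R)%R, e) = C) ->
    \sum_(p | c p == j) F p = b * C.
  move=> ltj FC.
  have -> : \sum_(p | c p == j) F p =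
      \sum_(e < d) \sum_(x : 'Z_L | x %% n == j) F ((x - e%:R)%R, e).
    rewrite sum_pair; apply: eq_bigr => e _.
    (* Each diagonal is reparametrized by its column coordinate modulo [L]. *)
    rewrite (reindex_inj (addIr (- e%:R)%R)); apply: eq_bigl => x.
    by rewrite /c (subrK (e%:R)%R x).
  rewrite exchange_big /= (eq_bigr (fun=> C)) => [|x _]; last exact: FC.
  exact: (sum_residue_const ZLn ltj).
have sumg (x : 'I_d -> 'Z_L) : \sum_(e < d) rho e (x e) = d * h ->
    \sum_(e < d) g (x e, e) = L * \sum_(e < d) e + d * h.
  by move=> <-; rewrite big_split /= big_distrr.
apply: (@magic_rectangle_of_labelling _ _ _ _ _ _ _ r c g).
- by move=> p; rewrite ltn_pmod.
- by move=> p; rewrite ltn_pmod.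
- move=> p; rewrite (_ : n * _ = L * d) /g; last by rewrite /n /L; lia.
  apply: (@leq_trans (L * p.2 + L)); first by rewrite ltn_add2l ltL.
  by rewrite -mulnSr leq_mul2l ltn_ord orbT.
- move=> [u e] [v f]; rewrite /r /c /= !valD // => ruv cuv.
  have ef : e = f :> nat.
    have := @diagonal_mod b a t u v 0 e 0 f.
    rewrite !addn0 !add0n => /(_ ruv cuv).
    by rewrite !modn_small // (leq_trans _ le_dt).
  congr (_, _); apply: val_inj => //=.
  apply: (@eq_of_modM b a t); rewrite ?(mulnC b a) //; first by rewrite coprime_sym.
  by apply/eqP; rewrite -(eqn_modDr e) -/n cuv ef.
- move=> [u e] [v f]; rewrite /g /= => /[dup] /(congr1 (divn^~ L)) ef guv.
  rewrite !(mulnC L) !divnMDl ?divn_small ?addn0 ?ltL // in ef; try lia.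
  move: guv; rewrite ef => /addnI /val_inj /rho_inj ->.
  by congr (_, _); apply: val_inj.
- by rewrite card_prod !card_ord ZL /n /L; lia.
- move=> i lti; apply: rowC => // x; by rewrite sum_nat_const card_ord muln1.
- move=> j ltj; apply: colC => // x; by rewrite sum_nat_const card_ord muln1.
- by move=> i lti; apply: rowC => // x; apply: (sumg (fun=> x)); apply: rowE.
- by move=> j ltj; apply: colC => // x; apply: (sumg (fun e => x - e%:R)%R); apply: colE.
Qed.

(** * Assembly from dominoes for even gcd *)

Lemma magic_rectangle_even a b t d : coprime a b -> 0 < a -> 0 < b ->
  1 < b * d -> 2 * d <= t ->
  exists A : pf_array (b * t) (a * t), magic_rectangle (a * (2 * d)) (b * (2 * d)) A.
Proof.
move=> co_ab a_gt0 b_gt0 bd_gt1 le_dt.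
have d_gt0 : 0 < d by lia.
have t_gt0 : 0 < t by lia.
pose L := a * b * t; set m := b * t; set n := a * t.
have m_gt0 : 0 < m by rewrite muln_gt0 b_gt0.
have n_gt0 : 0 < n by rewrite muln_gt0 a_gt0.
have eLm : L = a * m by rewrite /L /m mulnA.
have eLn : L = b * n by rewrite /L /n mulnCA mulnA.
have [|G [G_lt G_inj G_compl [C sumG]]] := @half_labelling_exists (b * d) n; first by lia.
set N := 2 * (b * d * n) in G_lt G_compl.
pose T : finType := ('I_L * 'I_d * bool)%type.
(* The pairs [(u %/ n, q)] enumerate the [b * d] rows of [G], so the left halves in column [j] carry
   exactly column [j] of [G]. *)
pose W u q := G (u %/ n * d + q) (u %% n).
(* Domino [(u, q)] covers columns [u] and [u + 1] of row [u + 2 * q]. Column minus row is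
   [e - 2 * q], which takes [2 * d] consecutive values, distinct modulo [t]. *)
pose r (p : T) := (p.1.1 + 2 * p.1.2) %% m.
pose c (p : T) := (p.1.1 + p.2) %% n.
pose g (p : T) := if p.2 then N - (W p.1.1 p.1.2).+1 else W p.1.1 p.1.2.
have idx_lt (u : 'I_L) (q : 'I_d) : u %/ n * d + q < b * d.
  have ltu : u %/ n < b by rewrite ltn_divLR // -eLn.
  apply: (@leq_trans (u %/ n * d + d)); first by rewrite ltn_add2l.
  by rewrite -mulSnr leq_mul2r ltu orbT.
have W_lt (u : 'I_L) (q : 'I_d) : W u q < N by rewrite G_lt ?ltn_pmod.
have W_inj (u v : 'I_L) (q f : 'I_d) : W u q = W v f -> (u, q) = (v, f).
  case/G_inj; rewrite ?ltn_pmod // => e1 e2.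
  have e3 := congr1 (modn^~ d) e1; rewrite /= !modnMDl (modn_small (ltn_ord q)) (modn_small (ltn_ord f)) in e3.
  have e4 := congr1 (divn^~ d) e1; rewrite /= !divnMDl // (divn_small (ltn_ord q)) (divn_small (ltn_ord f)) !addn0 in e4.
  congr (_, _); apply: val_inj => //=.
  by rewrite (divn_eq u n) (divn_eq v n) e4 e2.
have rowE F i : \sum_(p | r p == i) F p =
    \sum_(q < d) \sum_(u < L | (u + 2 * q) %% m == i) (F (u, q, true) + F (u, q, false)).
  rewrite sum_pair big_bool !sum_pair -big_split.
  by apply: eq_bigr => q _; rewrite -big_split.
have colE F j : \sum_(p | c p == j) F p =
    \sum_(q < d) \sum_(u < L | (u + 1) %% n == j) F (u, q, true)
    + \sum_(q < d) \sum_(u < L | u %% n == j) F (u, q, false).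
  rewrite sum_pair big_bool !sum_pair; congr (_ + _); apply: eq_bigr => q _; apply: eq_bigl => u //.
  by rewrite -[in RHS](addn0 u).
have constE N' k w i K : L = k * N' -> i < N' ->
    \sum_(q < d) \sum_(u < L | (u + w q) %% N' == i) K = d * (k * K).
  move=> eL lti; rewrite -[X in X * _](card_ord d) -sum_nat_const.
  apply: eq_bigr => q _; under eq_bigl => u do rewrite eq_mod_shift //.
  by rewrite (@sum_residue_const _ _ _ _ (fun=> K) K eL) // ltn_pmod //; lia.
have sumW j : j < n -> \sum_(q < d) \sum_(u < L | u %% n == j) W u q = C.
  move=> ltj; rewrite -(sumG j ltj) (sum_ord_mul _ _ (fun x => G x j)).
  rewrite [RHS]exchange_big; apply: eq_bigr => q _ /=.
  rewrite (sum_residue (fun u => W u q) eLn ltj); apply: eq_bigr => x _.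
  by rewrite /W divnMDl // (divn_small ltj) addn0 modnMDl modn_small.
(* In the column constant, the first summand comes from right halves and the final [C] from left
   halves. *)
apply: (@magic_rectangle_of_labelling _ _ _ _ (d * (a * N.-1))
          (d * (b * N.-1) - C + C) _ r c g).
- by move=> p; rewrite ltn_pmod.
- by move=> p; rewrite ltn_pmod.
- move=> [[u q] e]; have := W_lt u q; rewrite /g /= (_ : n * _ = N); last by rewrite /N; lia.
  case: e; lia.
- move=> [[u q] e] [[v f] e']; rewrite /r /c /= => ruv cuv.
  have := diagonal_mod ruv cuv.
  have ltq := ltn_ord q; have ltf := ltn_ord f.
  (* Both sides are below [2 * d <= t], so the congruence is an equality, and parity then separates
     [e] from [q]. *)
  rewrite !modn_small; try by case: (e) (e') => [] []; lia.
  move=> eqd.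
  have ee : e = e' by move: eqd; case: (e) (e') => [] [] //; lia.
  have qf : q = f :> nat by move: eqd; rewrite ee; lia.
  rewrite ee; congr (_, _, _); last exact: val_inj.
  apply: val_inj => /=; apply: (@eq_of_modM b a t); rewrite ?(mulnC b a) ?ltn_ord //.
  + by rewrite coprime_sym.
  + by apply/eqP; rewrite -(eqn_modDr (2 * q)) -/m ruv qf.
  + by apply/eqP; rewrite -(eqn_modDr e) -/n cuv ee.
- have W_compl (u v : 'I_L) (q f : 'I_d) : (W u q + W v f).+1 <> N.
    by apply: G_compl; rewrite ?ltn_pmod.
  move=> [[u q] e] [[v f] e']; rewrite /g /=.
  have := W_lt u q; have := W_lt v f; have := W_compl u v q f.
  case: e e' => [] [] h1 h2 h3 h4.
  + by have [-> ->] : (u, q) = (v, f) by apply: W_inj; lia.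
  + by exfalso; lia.
  + by exfalso; lia.
  + by have [-> ->] := W_inj _ _ _ _ h4.
- by rewrite !card_prod !card_ord card_bool /L /n; lia.
- by move=> i lti; rewrite rowE (constE _ _ (fun q => 2 * q) _ _ eLm lti); lia.
- move=> j ltj; rewrite colE (constE _ _ (fun=> 1) _ _ eLn ltj).
  under [X in _ + X]eq_bigr => q _ do under eq_bigl => u do rewrite -[u : nat]addn0.
  by rewrite (constE _ _ (fun=> 0) _ _ eLn ltj); lia.
- move=> i lti; rewrite rowE -(constE _ _ (fun q => 2 * q) _ _ eLm lti).
  apply: eq_bigr => q _; apply: eq_bigr => u _; rewrite /g /=.
  have := W_lt u q; lia.
- move=> j ltj; rewrite colE; congr (_ + _); last exact: sumW.
  rewrite -(constE _ _ (fun=> 1) _ _ eLn ltj).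
  (* Right halves in column [j] come from [u] congruent to [j - 1], written [j + 1 * n.-1]; the
     matching left labels sum to [C] as well. *)
  rewrite -(sumW ((j + 1 * n.-1) %% n)) ?ltn_pmod //.
  rewrite [X in _ - X](eq_bigr (fun q : 'I_d =>
    \sum_(u < L | (u + 1) %% n == j) W u q)) => [|q _]; last first.
    by apply: eq_bigl => u; rewrite eq_mod_shift.
  (* Adding the left labels back turns the claim into a termwise sum [N.-1] over dominoes. *)
  apply: esym; rewrite -[RHS](addnK (\sum_(q < d) \sum_(u < L | (u + 1) %% n == j) W u q)).
  congr (_ - _); rewrite -big_split; apply: eq_bigr => q _.
  rewrite -big_split; apply: eq_bigr => u _; rewrite /g /=.
  have := W_lt u q; lia.
Qed.

(** * Reduction to coprime [a], [b] and the split on the parity of the gcd *)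

Theorem theorem1p8 (m n s k : nat)
    (hs : 3 <= s <= n) (hk : 3 <= k <= m) (hmn : m * s = n * k)
    (hd : 2 <= gcdn s k) (hpar : ~~ odd (gcdn s k) \/ odd (n * k)) :
  exists A : pf_array m n, magic_rectangle s k A.
Proof.
set d := gcdn s k in hd hpar.
have d_gt0 : 0 < d by lia.
pose a := s %/ d; pose b := k %/ d.
have es : s = a * d by rewrite divnK // dvdn_gcdl.
have ek : k = b * d by rewrite divnK // dvdn_gcdr.
have a_gt0 : 0 < a by lia.
have b_gt0 : 0 < b by lia.
have co_ab : coprime a b.
  rewrite /coprime -(eqn_pmul2r d_gt0) muln_gcdl -es -ek mul1n.
  exact: eqxx.
have e : m * a = n * b by apply/eqP; rewrite -(eqn_pmul2r d_gt0) -!mulnA -es -ek hmn.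
pose t := n %/ a.
have en : n = a * t.
  rewrite mulnC divnK // -(Gauss_dvdl _ co_ab) -e; exact: dvdn_mull.
have em : m = b * t.
  by apply/eqP; rewrite -(eqn_pmul2r a_gt0) e {1}en; apply/eqP; lia.
have le_dt : d <= t by move: hs => /andP[_]; rewrite es en leq_pmul2l.
clearbody a b t; clear hmn e.
move: hs hk; rewrite es ek em en => hs hk.
rewrite en ek in hpar.
case od: (odd d) hpar => hpar.
- have {hpar}oL : odd (a * t * (b * d)) by case: hpar.
  apply: magic_rectangle_odd => //; last by lia.
  by move: oL; rewrite !oddM; case/andP=> /andP[-> ->] /andP[-> _].
- have ed : d = 2 * d./2 by lia.
  move: hk le_dt; rewrite ed => hk le_dt.
  (* Since [k] is twice [b * d./2], the bound [3 <= k] yields [1 < b * d./2], which excludes a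
     one-row half labelling. *)
  by apply: magic_rectangle_even => //; lia.
Qed.
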